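(* Let $\mathcal{R}$ be a commutative domain (with identity) with $\frac12\in\mathcal{R}$ and let $n\geq 3$. If $\mathfrak{l}\colon\mathcal{M}_n(\mathcal{R})\to\mathcal{M}_n(\mathcal{R})$ is a Lie isomorphism, then $\mathfrak{l}=\mathfrak{m}+\mathfrak{n}$, where $\mathfrak{m}\colon\mathcal{M}_n(\mathcal{R})\to\mathcal{M}_n(\mathcal{R})$ is an isomorphism or the negative of an anti-isomorphism of $\mathcal{R}$-algebras and $\mathfrak{n}\colon\mathcal{M}_n(\mathcal{R})\to\mathcal{R}1$ is an $\mathcal{R}$-linear mapping vanishing on each commutator.
   Context: $\mathcal{M}_n(\mathcal{R})$ is the algebra of $n\times n$ matrices over $\mathcal{R}$, and $[x,y]=xy-yx$. A Lie isomorphism is an $\mathcal{R}$-linear bijection $\mathfrak{l}$ with $\mathfrak{l}([x,y])=[\mathfrak{l}(x),\mathfrak{l}(y)]$ for all $x,y$. *)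

(* Defs.v *)
From mathcomp Require Import all_boot all_order all_algebra.

Set Implicit Arguments.
Unset Strict Implicit.
Unset Printing Implicit Defensive.

Import GRing.Theory.
Local Open Scope ring_scope.

(* 'M[R]_n, for a variable n, is canonically a ring and an R-module but not an
   algebra, so there is no {lrmorphism 'M[R]_n -> 'M[R]_n}; algebra morphisms
   are therefore functions that are linear, unital and (anti)multiplicative. *)

Definition lie_bracket (R : comNzRingType) (n : nat) (x y : 'M[R]_n) : 'M[R]_n :=
  x *m y - y *m x.

Definition lie_isomorphism (R : comNzRingType) (n : nat)
    (l : 'M[R]_n -> 'M[R]_n) : Prop :=
  [/\ linear l,
      bijective l &
      forall x y, l (lie_bracket x y) = lie_bracket (l x) (l y)].

Definition algebra_isomorphism (R : comNzRingType) (n : nat)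
    (m : 'M[R]_n -> 'M[R]_n) : Prop :=
  [/\ linear m,
      bijective m &
      m 1%:M = 1%:M /\ forall x y, m (x *m y) = m x *m m y].

Definition algebra_antiisomorphism (R : comNzRingType) (n : nat)
    (m : 'M[R]_n -> 'M[R]_n) : Prop :=
  [/\ linear m,
      bijective m &
      m 1%:M = 1%:M /\ forall x y, m (x *m y) = m y *m m x].

(* Main.v *)
From HB Require Import structures.
Require Import Defs.
From mathcomp Require Import all_boot all_order all_algebra.
From mathcomp Require Import ring.

(* Write [B x y = l (phi x o phi y)], where [phi] is the inverse of [l] and
   [x o y = x y + y x].  Applying [l] to the identity [[x o y, z] + cyclic = 0]
   gives [[B x y, z] + [B y z, x] + [B z x, y] = 0], so [B] is the polarization
   of a commuting trace.  Evaluating this on matrix units forces, for [n >= 3],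
   [B x y = lam (x o y) + mu x . y + mu y . x + scalar] with [mu] linear.  Hence
   [J x = lam . l x + mu (l x) / 2] satisfies [J (x o y) = J x o J y + scalar].
   The associator identity [(x o y) o z - x o (y o z) = [y, [x, z]]] combined
   with [l] being a Lie map shows that [lam ^ 2 = 1] and that the scalar defect
   vanishes.  Since [J] is then compatible with both the Jordan product and,
   up to the sign [lam], the Lie bracket, it is an isomorphism if [lam = 1] and
   an anti-isomorphism if [lam = -1]. *)

Set Implicit Arguments.
Unset Strict Implicit.
Unset Printing Implicit Defensive.

Import GRing.Theory.
Local Open Scope ring_scope.

(** * Entries of products and brackets with matrix units [e_ab] *)

Lemma mulmx_deltaE (R : comNzRingType) (n : nat) (A : 'M[R]_n) (a b p q : 'I_n) :
  (A *m delta_mx a b) p q = A p a * (q == b)%:R.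
Proof.
rewrite mxE (bigD1 a) //= big1 ?addr0 => [|k /negbTE ka]; first by rewrite mxE eqxx.
by rewrite mxE ka mulr0.
Qed.

Lemma delta_mulmxE (R : comNzRingType) (n : nat) (A : 'M[R]_n) (a b p q : 'I_n) :
  (delta_mx a b *m A) p q = (p == a)%:R * A b q.
Proof.
rewrite mxE (bigD1 b) //= big1 ?addr0 => [|k /negbTE kb]; first by rewrite mxE eqxx andbT.
by rewrite mxE kb andbF mul0r.
Qed.

Lemma bracket_deltaE (R : comNzRingType) (n : nat) (A : 'M[R]_n) (a b p q : 'I_n) :
  lie_bracket A (delta_mx a b) p q
  = A p a * (q == b)%:R - (p == a)%:R * A b q.
Proof. by rewrite /lie_bracket mxE mulmx_deltaE [in LHS]mxE delta_mulmxE. Qed.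

Lemma bracket_delta (R : comNzRingType) (n : nat) (i j k : 'I_n) : i != k ->
  lie_bracket (delta_mx i j) (delta_mx j k) = delta_mx i k :> 'M[R]_n.
Proof.
by move=> ik; rewrite /lie_bracket mul_delta_mx mul_delta_mx_0 1?eq_sym // subr0.
Qed.

(** A counting argument; [n >= 3] enters the later computations mostly in this form. *)
Lemma fresh_ord n (n_ge3 : (3 <= n)%N) (i k : 'I_n) : exists p, p != i /\ p != k.
Proof.
have /card_gt0P[p] : (0 < #|[predC [:: i; k]]|)%N.
  have := cardC (mem [:: i; k]); rewrite card_ord => e.
  have := card_size [:: i; k] => /= h.
  by rewrite -(ltn_add2l #|[:: i; k]|) addn0 e (leq_trans _ n_ge3) // ltnS.
by rewrite !inE negb_or => /andP[]; exists p.
Qed.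

Lemma three_indices n (n_ge3 : (3 <= n)%N) : exists i j k : 'I_n, [/\ i != j, i != k & j != k].
Proof.
have n0 : (0 < n)%N by apply: leq_trans n_ge3.
have [j [ji _]] := fresh_ord n_ge3 (Ordinal n0) (Ordinal n0).
have [k [ki kj]] := fresh_ord n_ge3 (Ordinal n0) j.
by exists (Ordinal n0), j, k; split; rewrite 1?eq_sym // eq_sym.
Qed.

Ltac neqs := repeat (rewrite ?eqxx /=; match goal with
  | H : is_true (~~ (?a == ?b)) |- context [?a == ?b] => rewrite (negbTE H)
  | H : is_true (~~ (?a == ?b)) |- context [?b == ?a] => rewrite (eq_sym b a) (negbTE H)
  end).

Ltac zeros := rewrite ?eqxx ?(mulr0, mul0r, mulr1, mul1r, subr0, addr0, add0r, sub0r, oppr0).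

(** * The Lie bracket and centralizers of matrix units *)

Section LieBracket.
Variables (R : comNzRingType) (n : nat).
Implicit Types A B C : 'M[R]_n.

Lemma lie_bracket0 A : lie_bracket 0 A = 0.
Proof. by rewrite /lie_bracket mul0mx mulmx0 subr0. Qed.

Lemma lie_bracketN A B : lie_bracket A B = - lie_bracket B A.
Proof. by rewrite /lie_bracket opprB. Qed.

Lemma lie_bracket_scalar c A : lie_bracket c%:M A = 0.
Proof. by rewrite /lie_bracket scalar_mxC subrr. Qed.

Lemma lie_bracketDl A B C : lie_bracket (A + B) C = lie_bracket A C + lie_bracket B C.
Proof. by rewrite /lie_bracket mulmxDl mulmxDr opprD addrACA. Qed.

Lemma lie_bracketZl c A B : lie_bracket (c *: A) B = c *: lie_bracket A B.
Proof. by rewrite /lie_bracket -scalemxAl -scalemxAr scalerBr. Qed.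

Lemma lie_bracketZr c A B : lie_bracket A (c *: B) = c *: lie_bracket A B.
Proof. by rewrite lie_bracketN lie_bracketZl -scalerN -lie_bracketN. Qed.

Lemma lie_bracketBl A B C : lie_bracket (A - B) C = lie_bracket A C - lie_bracket B C.
Proof. by rewrite lie_bracketDl -scaleN1r lie_bracketZl scaleN1r. Qed.

Lemma lie_bracket_affine a c d A B :
  lie_bracket (a *: A + c%:M) (a *: B + d%:M) = a ^+ 2 *: lie_bracket A B.
Proof.
rewrite lie_bracketDl lie_bracket_scalar addr0 lie_bracketN lie_bracketDl.
rewrite lie_bracket_scalar addr0 -lie_bracketN lie_bracketZl lie_bracketZr.
by rewrite scalerA expr2.
Qed.

(** This equation confines the centralizer of [e_ab]: off the diagonal, column [a] and row [b]
    vanish, and the diagonal entries at [a] and [b] agree. The next three lemmas extract these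
    facts. *)
Lemma comm_entry A a b p q : lie_bracket A (delta_mx a b) = 0 ->
  A p a * (q == b)%:R = (p == a)%:R * A b q.
Proof. by move=> /matrixP/(_ p q); rewrite bracket_deltaE mxE => /eqP; rewrite subr_eq0 => /eqP. Qed.

Lemma comm_col A a b p : lie_bracket A (delta_mx a b) = 0 ->
  p != a -> A p a = 0.
Proof. by move=> /(comm_entry p b) + /negbTE pa; rewrite eqxx pa mulr1 mul0r. Qed.

Lemma comm_row A a b q : lie_bracket A (delta_mx a b) = 0 ->
  q != b -> A b q = 0.
Proof. by move=> /(comm_entry a q) + /negbTE qb; rewrite eqxx qb mul1r mulr0. Qed.

Lemma comm_diag A a b : lie_bracket A (delta_mx a b) = 0 -> A a a = A b b.
Proof. by move=> /(comm_entry a b); rewrite !eqxx mul1r mulr1. Qed.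

End LieBracket.

Section MatrixUnits.
Variables (R : comNzRingType) (n : nat).

Lemma linear_delta_eq0 (V : lmodType R) (f : {linear 'M[R]_n -> V}) :
  (forall i j, f (delta_mx i j) = 0) -> forall x, f x = 0.
Proof.
move=> f0 x; rewrite (matrix_sum_delta x) linear_sum big1 // => i _.
by rewrite linear_sum big1 // => j _; rewrite linearZ /= f0 scaler0.
Qed.

Lemma deltaZ_eq (A : 'M[R]_n) k l : (forall p q, (p, q) != (k, l) -> A p q = 0) ->
  A = A k l *: delta_mx k l.
Proof.
move=> A0; apply/matrixP=> p q; rewrite !mxE -[_ && _]/((p, q) == (k, l)).
by case: eqVneq => [[-> ->]|/A0 ->]; rewrite ?mulr1 ?mulr0.
Qed.

Lemma delta2Z_eq (A : 'M[R]_n) i k : i != k -> A i i = A k k ->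
  (forall p q, p != q -> A p q = 0) -> (forall p, p != i -> p != k -> A p p = 0) ->
  A = A k k *: (delta_mx i i + delta_mx k k).
Proof.
move=> ik Aik Aoff Adiag; apply/matrixP=> p q; rewrite !mxE.
have [->|pq] := eqVneq p q; last first.
  rewrite Aoff //; have [pi|pi] := eqVneq p i; last have [pk|pk] := eqVneq p k.
  - by rewrite pi in pq *; neqs; zeros.
  - by rewrite pk in pq *; neqs; zeros.
  - by zeros.
have [->|qi] := eqVneq q i; first by neqs; zeros.
have [->|qk] := eqVneq q k; first by zeros.
by zeros; rewrite Adiag.
Qed.

End MatrixUnits.

(** * Scalar matrices as the centre of the Lie algebra *)

Section ScalarMatrices.
Variables (R : comNzRingType) (n : nat).
Implicit Types A B : 'M[R]_n.

Lemma is_scalar_mxD A B : is_scalar_mx A -> is_scalar_mx B -> is_scalar_mx (A + B).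
Proof.
move=> /is_scalar_mxP[a ->] /is_scalar_mxP[b ->].
by rewrite -raddfD; apply: scalar_mx_is_scalar.
Qed.

Lemma is_scalar_mxZ a A : is_scalar_mx A -> is_scalar_mx (a *: A).
Proof.
by move=> /is_scalar_mxP[b ->]; rewrite scale_scalar_mx; apply: scalar_mx_is_scalar.
Qed.

Lemma is_scalar_mxN A : is_scalar_mx A -> is_scalar_mx (- A).
Proof. by rewrite -scaleN1r; apply: is_scalar_mxZ. Qed.

Lemma is_scalar_mxB A B : is_scalar_mx A -> is_scalar_mx B -> is_scalar_mx (A - B).
Proof. by move=> ? /is_scalar_mxN; apply: is_scalar_mxD. Qed.

Lemma is_scalar_mx_linear (f : {linear 'M[R]_n -> 'M[R]_n}) :
  (forall i j, is_scalar_mx (f (delta_mx i j))) -> forall x, is_scalar_mx (f x).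
Proof.
move=> fS x; rewrite (matrix_sum_delta x) linear_sum.
have S0 : is_scalar_mx (0 : 'M[R]_n) by rewrite -(raddf0 (@scalar_mx R n)) scalar_mx_is_scalar.
apply: (big_ind (@is_scalar_mx R n)) => // [A B|i _]; first exact: is_scalar_mxD.
rewrite linear_sum; apply: (big_ind (@is_scalar_mx R n)) => // [A B|j _]; first exact: is_scalar_mxD.
by rewrite linearZ; apply: is_scalar_mxZ.
Qed.

Lemma is_scalar_mx_offdiag A p q : is_scalar_mx A -> p != q -> A p q = 0.
Proof. by case/is_scalar_mxP=> a -> /negbTE pq; rewrite mxE pq. Qed.

End ScalarMatrices.

Section ScalarMatricesDomain.
Variables (R : idomainType) (n : nat).
Implicit Types A : 'M[R]_n.

(** Commuting with [e_qq] clears column [q] off the diagonal; commuting with [e_q0] equates the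
    diagonal entries at [q] and [0]. *)
Lemma is_scalar_mx_central A : (forall z, lie_bracket A z = 0) -> is_scalar_mx A.
Proof.
case: n A => [|n'] A cA; first by apply/is_scalar_mxP; exists 0; apply/matrixP=> - [].
apply/is_scalar_mxP; exists (A 0 0); apply/matrixP=> p q; rewrite mxE.
have [->|pq] := eqVneq p q; first exact: comm_diag (cA (delta_mx q 0)).
by apply: comm_col (cA (delta_mx q q)) _.
Qed.

(** Since [a] need not be invertible, it is cancelled from [a *: [A, z] = 0] instead, which makes
    [A] central. *)
Lemma is_scalar_mxZ_inv a A : a != 0 -> is_scalar_mx (a *: A) -> is_scalar_mx A.
Proof.
move=> a0 /is_scalar_mxP[c /matrixP aA]; apply: is_scalar_mx_central => z.
have : a *: lie_bracket A z = 0.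
  rewrite -lie_bracketZl; have -> : a *: A = c%:M by apply/matrixP.
  exact: lie_bracket_scalar.
move/matrixP=> h; apply/matrixP=> p q; have := h p q; rewrite !mxE => /eqP.
by rewrite mulf_eq0 (negbTE a0) => /eqP.
Qed.

End ScalarMatricesDomain.

(** * Commuting traces on matrix units *)

Section Family.
Variables (R : idomainType) (n : nat).
Hypothesis half : (2%:R : R) \is a GRing.unit.
Hypothesis n_ge3 : (3 <= n)%N.

Lemma double_eq0 (x : R) : x + x = 0 -> x = 0.
Proof.
move/eqP; rewrite -mulr2n -mulr_natl mulf_eq0 => /orP[/eqP h|/eqP //].
by move: half; rewrite h unitr0.
Qed.

(* [P i j k l] stands for [B e_ij e_kl] stripped of its scalar part and of the
   multiples of [e_ij] and [e_kl] that come from the diagonal values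
   [B e_ij e_ij]. *)
Record bracket_family (P : 'I_n -> 'I_n -> 'I_n -> 'I_n -> 'M[R]_n) : Prop := {
  fam_row : forall i j k l p q, p != i -> p != k -> P i j k l p q = 0;
  fam_col : forall i j k l p q, q != j -> q != l -> P i j k l p q = 0;
  fam_sym : forall i j k l, P i j k l = P k l i j;
  fam_diag : forall i j, P i j i j = 0;
  fam_jacobi : forall i j k l a b,
    lie_bracket (P i j k l) (delta_mx a b) + lie_bracket (P k l a b) (delta_mx i j)
    + lie_bracket (P a b i j) (delta_mx k l) = 0 }.

(** Transposition reverses brackets, so the three signs factor out of the Jacobi identity. This
    duality turns column statements into row statements. *)
Lemma bracket_family_tr P :
  bracket_family P -> bracket_family (fun i j k l => (P j i l k)^T).
Proof.
case=> hr hc hs hd hj; split=> [i j k l p q ? ?|i j k l p q ? ?|i j k l|i j|i j k l a b].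
- by rewrite mxE hc.
- by rewrite mxE hr.
- by rewrite hs.
- by rewrite hd trmx0.
have tr (A : 'M[R]_n) c d :
    lie_bracket A^T (delta_mx c d) = - (lie_bracket A (delta_mx d c))^T.
  by rewrite /lie_bracket linearB /= !trmx_mul trmx_delta opprB.
by rewrite !tr -!opprD -!linearD /= hj trmx0 oppr0.
Qed.

(** * Pairs of matrix units sharing a row or a column *)

Section SharedIndex.
Variable P : 'I_n -> 'I_n -> 'I_n -> 'I_n -> 'M[R]_n.
Hypothesis famP : bracket_family P.

Lemma fam_jacobi_entry i j k l a b p q :
  P i j k l p a * (q == b)%:R - (p == a)%:R * P i j k l b q
  + (P k l a b p i * (q == j)%:R - (p == i)%:R * P k l a b j q)
  + (P a b i j p k * (q == l)%:R - (p == k)%:R * P a b i j l q) = 0.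
Proof.
have /matrixP/(_ p q) := fam_jacobi famP i j k l a b.
by rewrite !mxE -!bracket_deltaE !mxE.
Qed.

(** Repeating [e_ij] in the Jacobi identity gives this bracket twice, by symmetry, plus a term with
    [P i j i j = 0]; then 2 is cancelled. *)
Lemma fam_comm1 i j k l : lie_bracket (P i j k l) (delta_mx i j) = 0.
Proof.
have := fam_jacobi famP i j k l i j; rewrite (fam_diag famP) (fam_sym famP k l).
rewrite {3}/lie_bracket mul0mx mulmx0 subr0 addr0 => /matrixP h.
by apply/matrixP=> p q; have := h p q; rewrite mxE [RHS]mxE => /double_eq0 ->; rewrite mxE.
Qed.

Lemma fam_same_col_entry i j k : i != k -> P i j k j i j = 0.
Proof.
move=> ik; have [ij|ij] := eqVneq i j.
  rewrite -{}ij; have c := fam_comm1 k i i i; rewrite -(fam_sym famP) in c.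
  by rewrite -(comm_diag c) (fam_col famP) // eq_sym.
have := fam_jacobi_entry i j k j j i i i.
have Pji : P k j j i j i = 0 by apply: comm_row (fam_comm1 k j j i) _.
by rewrite !eqxx (negbTE ij) (negbTE ik) Pji !(mul0r, mulr0, mulr1, subr0, addr0).
Qed.

Lemma fam_same_col i j k : P i j k j = 0.
Proof.
have [->|ik] := eqVneq i k; first exact: fam_diag.
apply/matrixP=> p q; rewrite mxE.
have [->|qj] := eqVneq q j; last by apply: fam_col.
have [->|pi] := eqVneq p i; first exact: fam_same_col_entry.
have [->|pk] := eqVneq p k; last by apply: fam_row.
by rewrite (fam_sym famP) fam_same_col_entry // eq_sym.
Qed.

End SharedIndex.

Lemma fam_same_row P : bracket_family P -> forall i j l, P i j i l = 0.
Proof.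
move=> /bracket_family_tr famP i j l.
by have /(congr1 trmx) := fam_same_col famP j i l; rewrite trmxK trmx0.
Qed.

(** * Coefficients for each pattern of coinciding indices *)

Section Shape.
Variable P : 'I_n -> 'I_n -> 'I_n -> 'I_n -> 'M[R]_n.
Hypothesis famP : bracket_family P.

(** For the mixed units [e_il] and [e_kj], the two other Jacobi terms involve pairs sharing a row or
    a column, hence vanish. *)
Lemma fam_comm i j k l a b : a \in [:: i; k] -> b \in [:: j; l] ->
  lie_bracket (P i j k l) (delta_mx a b) = 0.
Proof.
rewrite !inE => /orP[]/eqP -> /orP[]/eqP ->; first exact: fam_comm1.
- have := fam_jacobi famP i j k l i l.
  by rewrite (fam_same_col famP) (fam_same_row famP) !lie_bracket0 !addr0.
- have := fam_jacobi famP i j k l k j.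
  by rewrite (fam_same_col famP) (fam_same_row famP) !lie_bracket0 !addr0.
by rewrite (fam_sym famP); apply: fam_comm1.
Qed.

(** Outside the support the entry is zero. If [p] is also a column index, commuting with [e_ip]
    clears row [p]; if [q] is also a row index, commuting with [e_qj] clears column [q]. *)
Lemma fam_offdiag i j k l p q : p != q ->
  ~~ [&& p \in [:: i; k], p \notin [:: j; l], q \in [:: j; l] & q \notin [:: i; k]] ->
  P i j k l p q = 0.
Proof.
move=> pq.
have [pik|] := boolP (p \in [:: i; k]); last first.
  by rewrite !inE negb_or => /andP[] *; apply: fam_row.
have [qjl|] := boolP (q \in [:: j; l]); last first.
  by rewrite !inE negb_or => /andP[] *; apply: fam_col.
rewrite /= negb_and !negbK => /orP[pjl|qik].
  apply: (comm_row (fam_comm (mem_head _ _) pjl)); by rewrite eq_sym.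
exact: (comm_col (fam_comm qik (mem_head _ _))).
Qed.

(** Commuting with [e_pj] and [e_ij] links the diagonal entries at [p], [j] and [i], and the last
    lies outside the column support. *)
Lemma fam_diag_eq0 i j k l p : i \notin [:: j; l] -> P i j k l p p = 0.
Proof.
move=> ijl.
have Pi : P i j k l i i = 0 by move: ijl; rewrite !inE negb_or => /andP[? ?]; apply: fam_col.
have [pik|] := boolP (p \in [:: i; k]); last first.
  by rewrite !inE negb_or => /andP[] *; apply: fam_row.
rewrite (comm_diag (fam_comm pik (mem_head _ _))).
by rewrite -(comm_diag (fam_comm (mem_head _ _) (mem_head j _))).
Qed.

(** This lemma and the next three leave a single unknown coefficient for each pattern; the Jacobi
    identity then relates these coefficients. *)
Lemma fam_iikl i k l : i != k -> i != l -> k != l ->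
  P i i k l = P i i k l k l *: delta_mx k l.
Proof.
move=> ik il kl; apply: deltaZ_eq => p q; rewrite xpair_eqE negb_and => pqkl.
have [->|pq] := eqVneq p q.
  by rewrite (fam_sym famP) fam_diag_eq0 // !inE; neqs.
apply: fam_offdiag => //; apply: contraL pqkl; rewrite !inE.
case/and4P => /orP[/eqP->|/eqP->]; neqs => // _.
by case/orP=> /eqP->; neqs.
Qed.

Lemma fam_kiil i k l : i != k -> i != l -> k != l ->
  P k i i l = P k i i l k l *: delta_mx k l.
Proof.
move=> ik il kl; apply: deltaZ_eq => p q; rewrite xpair_eqE negb_and => pqkl.
have [->|pq] := eqVneq p q.
  by rewrite fam_diag_eq0 // !inE; neqs.
apply: fam_offdiag => //; apply: contraL pqkl; rewrite !inE.
case/and4P => /orP[/eqP->|/eqP->]; neqs => // _.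
by case/orP=> /eqP->; neqs.
Qed.

Lemma fam_iikk i k : i != k ->
  P i i k k = P i i k k k k *: (delta_mx i i + delta_mx k k).
Proof.
move=> ik; apply: delta2Z_eq => // [|p q pq|p pi pk].
- by apply: (@comm_diag _ _ _ i k); apply: fam_comm; rewrite !inE eqxx ?orbT.
- by apply: fam_offdiag => //; case: (p \in _); rewrite ?andbF.
- exact: (fam_row famP).
Qed.

Lemma fam_ikki i k : i != k ->
  P i k k i = P i k k i k k *: (delta_mx i i + delta_mx k k).
Proof.
move=> ik; apply: delta2Z_eq => // [|p q pq|p pi pk].
- by apply: (@comm_diag _ _ _ i k); apply: fam_comm; rewrite !inE eqxx ?orbT.
- by apply: fam_offdiag => //; apply/negP => /and4P[]; rewrite !inE orbC => ->.
- exact: (fam_row famP).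
Qed.

Lemma fam_iikl_left i k l : i != k -> i != l -> k != l -> P i i k l k l = P i i k k k k.
Proof.
move=> ik il kl; have := fam_jacobi_entry famP i i k k k l k l.
rewrite (fam_same_row famP k k l) (fam_sym famP k l) (fam_iikk ik) !mxE.
by neqs; zeros => /eqP; rewrite subr_eq0 => /eqP.
Qed.

Lemma fam_iikl_right i k l : i != k -> i != l -> k != l -> P i i k l k l = P i i l l l l.
Proof.
move=> ik il kl; have := fam_jacobi_entry famP i i l l k l k l.
rewrite (fam_same_col famP l l k) (fam_sym famP k l) (fam_iikk il) !mxE.
by neqs; zeros => /eqP; rewrite addrC subr_eq0 => /eqP.
Qed.

Lemma fam_kiil_coef i k l : i != k -> i != l -> k != l -> P k i i l k l = - P k k i l i l.
Proof.
move=> ik il kl; have := fam_jacobi_entry famP k i i l k k k l.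
rewrite (fam_same_row famP k k i) (fam_sym famP i l) !mxE.
by neqs; zeros => /eqP; rewrite -opprD oppr_eq0 addr_eq0 => /eqP.
Qed.

Lemma fam_ikki_coef i k l : i != k -> i != l -> k != l -> P i k k i k k = P k i i l k l.
Proof.
move=> ik il kl; have := fam_jacobi_entry famP i k k i i l i l.
rewrite (fam_same_row famP i l k) (fam_ikki ik) !mxE.
by neqs; zeros => /eqP; rewrite subr_eq0 => /eqP.
Qed.

(** In the Jacobi identity at [e_ij], [e_kl], [e_li], the last two terms are multiples of [e_kj], so
    every other entry of [[P i j k l, e_li]] vanishes. *)
Lemma fam_disjoint_aux i j k l : uniq [:: i; j; k; l] ->
  [/\ P i j k l k l = 0, P i j k l i l = 0 & P i j k l i j = 0].
Proof.
rewrite /= !inE !negb_or => /and4P[/and3P[ij ik il] /andP[jk jl] kl _].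
have := fam_jacobi_entry famP i j k l l i.
have -> : P k l l i = P k l l i k i *: delta_mx k i by apply: fam_kiil; neqs.
have -> : P l i i j = P l i i j l j *: delta_mx l j by apply: fam_kiil; neqs.
move: (P k l l i k i) (P l i i j l j) => u v h.
split; [have := h k i|have := h i i|have := h l j]; rewrite !mxE; neqs; zeros => //.
by move/eqP; rewrite oppr_eq0 => /eqP.
Qed.

Lemma fam_disjoint i j k l : uniq [:: i; j; k; l] -> P i j k l = 0.
Proof.
move=> u; have [Pkl Pil Pij] := fam_disjoint_aux u.
have [|_ Pkj _] := @fam_disjoint_aux k l i j.
  by rewrite -(perm_uniq (permEl (perm_catC [:: i; j] [:: k; l]))).
rewrite (fam_sym famP) in Pkj.
apply/matrixP=> p q; rewrite mxE.
have [->|pi] := eqVneq p i; last have [->|pk] := eqVneq p k; last exact: (fam_row famP).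
all: have [->|qj] := eqVneq q j; last have [->|ql] := eqVneq q l; last exact: (fam_col famP).
all: by [].
Qed.

(** One index of the pair can be replaced while the other is kept, and the two can be swapped; an
    index [c] outside [{i, j}] connects any two pairs. *)
Lemma fam_beta_const i k j m : i != k -> j != m -> P i i k k k k = P j j m m m m.
Proof.
have step a b c : a != b -> a != c -> P a a b b b b = P a a c c c c.
  move=> ab ac; have [<-//|bc] := eqVneq b c.
  by rewrite -(fam_iikl_left ab ac bc) fam_iikl_right.
have swap a b : a != b -> P a a b b b b = P b b a a a a.
  move=> ab; rewrite (fam_sym famP); apply/esym.
  by apply: (@comm_diag _ _ _ a b); apply: fam_comm; rewrite !inE eqxx ?orbT.
have [c [ci cj]] := fresh_ord n_ge3 i j; rewrite eq_sym in ci; rewrite eq_sym in cj.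
move=> ik jm; rewrite (step i k c) // (swap i c) // (step c i j) 1?eq_sym //.
by rewrite -(swap j c) // (step j c m).
Qed.

(** The bracketed expression is [x o y - tr(x) y - tr(y) x] for [x = e_ij] and [y = e_kl]. *)
Theorem bracket_family_shape : exists lam, forall i j k l, P i j k l =
  lam *: ((j == k)%:R *: delta_mx i l + (l == i)%:R *: delta_mx k j
          - (i == j)%:R *: delta_mx k l - (k == l)%:R *: delta_mx i j).
Proof.
have [i0 [k0 ik0]] : exists i0 k0 : 'I_n, i0 != k0.
  by exists (Ordinal (ltnW (ltnW n_ge3))), (Ordinal (ltnW n_ge3)).
(* For [P i i k k] only the trace terms of the formula survive, hence the sign. *)
exists (- P i0 i0 k0 k0 k0 k0); set lam := - _.
have beta i k : i != k -> P i i k k k k = - lam.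
  by move=> ik; rewrite opprK; apply: fam_beta_const.
have alpha i k l : i != k -> i != l -> k != l -> P i i k l k l = - lam.
  by move=> *; rewrite fam_iikl_left // beta.
have alpha' i k l : i != k -> i != l -> k != l -> P k i i l k l = lam.
  by move=> *; rewrite fam_kiil_coef // alpha ?opprK // eq_sym.
move=> i j k l.
have [<-|ik] := eqVneq i k.
  rewrite (fam_same_row famP); apply/esym/eqP.
  by rewrite [j == i]eq_sym [l == i]eq_sym addrAC addrK subrr scaler0.
have [<-|jl] := eqVneq j l.
  rewrite (fam_same_col famP); apply/esym/eqP.
  by rewrite [j == k]eq_sym [j == i]eq_sym addrK subrr scaler0.
have [ij|ij] := eqVneq i j.
  subst j; have [kl|kl] := eqVneq k l.
    by subst l; rewrite fam_iikk // beta //; neqs; rewrite !scale0r !scale1r addr0 sub0r -opprD scalerN scaleNr addrC.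
  by rewrite fam_iikl // alpha //; neqs; rewrite !scale0r !scale1r addr0 sub0r subr0 scalerN scaleNr.
have [kl|kl] := eqVneq k l.
  subst l; rewrite (fam_sym famP) fam_iikl // 1?eq_sym // alpha // 1?eq_sym //.
  by neqs; rewrite !scale0r !scale1r !(addr0, oppr0, add0r) scalerN scaleNr.
have [jk|jk] := eqVneq j k.
  subst k; have [li|li] := eqVneq l i.
    (* The coefficient of [P i j j i] is reached only through a third index. *)
    subst l; have [m [mi mj]] := fresh_ord n_ge3 i j.
    rewrite fam_ikki // (@fam_ikki_coef i j m) // 1?eq_sym // alpha' // 1?eq_sym //.
    by rewrite !scale0r !scale1r !subr0.
  by rewrite fam_kiil // 1?eq_sym // alpha' // 1?eq_sym // !scale0r !scale1r !subr0 addr0.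
have [li|li] := eqVneq l i.
  subst l; rewrite (fam_sym famP) fam_kiil // 1?eq_sym // alpha' // 1?eq_sym //.
  by rewrite !scale0r !scale1r !subr0 add0r.
rewrite fam_disjoint; first by rewrite !scale0r !subr0 addr0 scaler0.
by rewrite /= !inE; neqs.
Qed.

End Shape.
End Family.

(** * Commuting traces of bilinear maps *)

Section CommutingTrace.
Variables (R : idomainType) (n : nat).
Hypothesis half : (2%:R : R) \is a GRing.unit.
Hypothesis n_ge3 : (3 <= n)%N.
Variable B : 'M[R]_n -> 'M[R]_n -> 'M[R]_n.
Hypothesis Bsym : forall x y, B x y = B y x.
Hypothesis Blin : forall x, linear (B x).
Hypothesis Bjac : forall x y z,
  lie_bracket (B x y) z + lie_bracket (B y z) x + lie_bracket (B z x) y = 0.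

Let Bd i j k l := B (delta_mx i j) (delta_mx k l).

(* If [p] avoids [i, k] and [q] avoids [j, l], then row [p] and column [q] of
   [e_ij] and [e_kl] vanish, so the last two brackets of [Bjac] have a zero
   [(p, q)] entry, whatever the third argument. *)
Lemma trace_support i j k l : exists c, forall p q,
  (p != i) && (p != k) || (q != j) && (q != l) -> Bd i j k l p q = c * (p == q)%:R.
Proof.
have cross p q a b : p != i -> p != k -> q != j -> q != l ->
    Bd i j k l p a * (q == b)%:R = (p == a)%:R * Bd i j k l b q.
  move=> pi pk qj ql.
  have /matrixP/(_ p q) := Bjac (delta_mx i j) (delta_mx k l) (delta_mx a b).
  rewrite mxE [in X in X + _]mxE !bracket_deltaE.
  rewrite (negbTE pi) (negbTE pk) (negbTE qj) (negbTE ql) mxE.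
  rewrite !(mulr0, mul0r, subr0, addr0) => /eqP.
  by rewrite subr_eq0 => /eqP.
have [p0 [pi pk]] := fresh_ord n_ge3 i k; have [q0 [qj ql]] := fresh_ord n_ge3 j l.
have pq : Bd i j k l p0 p0 = Bd i j k l q0 q0.
  by have := cross p0 q0 p0 q0 pi pk qj ql; rewrite !eqxx mulr1 mul1r.
exists (Bd i j k l p0 p0) => p q /orP[] /andP[h1 h2].
  by have := cross p q0 q q0 h1 h2 qj ql; rewrite eqxx mulr1 => ->; rewrite mulrC pq.
by have := cross p0 q p0 p pi pk h1 h2; rewrite eqxx mul1r => <-; rewrite eq_sym.
Qed.

Theorem commuting_trace : exists lam (mu : 'M[R]_n -> R), scalar mu /\
  forall x y, is_scalar_mx (B x y - (lam *: (x *m y + y *m x) + mu x *: y + mu y *: x)).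
Proof.
have /fin_all_exists[c' hc'] (t : 'I_n * 'I_n * 'I_n * 'I_n) := trace_support t.1.1.1 t.1.1.2 t.1.2 t.2.
pose c i j k l := c' (i, j, k, l).
have hc i j k l p q : (p != i) && (p != k) || (q != j) && (q != l) ->
  Bd i j k l p q = c i j k l * (p == q)%:R := hc' (i, j, k, l) p q.
(* Chosen so that [B e_ij e_ij] is [2 a_ij e_ij] plus a scalar, which makes [P i j i j] vanish. *)
pose a i j := 2%:R^-1 * (Bd i j i j i j - c i j i j * (i == j)%:R).
have a2 i j : a i j + a i j = Bd i j i j i j - c i j i j * (i == j)%:R.
  by rewrite -mulr2n -[_ *+ 2]mulr_natl /a mulrA divrr // mul1r.
pose P i j k l := Bd i j k l - a i j *: delta_mx k l - a k l *: delta_mx i j - (c i j k l)%:M.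
have csym i j k l : c i j k l = c k l i j.
  have [p [pi pk]] := fresh_ord n_ge3 i k.
  have := hc i j k l p p; rewrite pi pk => /(_ isT); rewrite /Bd Bsym eqxx mulr1 => <-.
  by have := hc k l i j p p; rewrite pi pk => /(_ isT); rewrite eqxx mulr1 => <-.
have famP : bracket_family P.
  split=> [i j k l p q pi pk|i j k l p q qj ql|i j k l|i j|i j k l a1 b].
  - by rewrite /P !mxE hc ?pi ?pk // (negbTE pi) (negbTE pk) mulr_natr !mulr0 !subr0 subrr.
  - rewrite /P !mxE hc ?qj ?ql ?orbT // (negbTE qj) (negbTE ql) !andbF.
    by rewrite mulr_natr !mulr0 !subr0 subrr.
  - by rewrite /P /Bd Bsym csym [X in X - _ = _]addrAC.
  - apply/matrixP=> p q; rewrite /P !mxE.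
    have [->|pi] := eqVneq p i; last by rewrite hc ?pi // mulr_natr !mulr0 !subr0 subrr.
    have [->|qj] := eqVneq q j; last by rewrite hc ?qj ?orbT // mulr_natr !mulr0 !subr0 subrr.
    rewrite /= mulr1 -mulr_natr -addrA -opprD -addrA -opprD addrA a2.
    by rewrite subrK subrr.
  - rewrite /P !lie_bracketBl !lie_bracketZl !lie_bracket_scalar !subr0.
    (* The multiples of matrix units contribute brackets that cancel in pairs by antisymmetry. *)
    rewrite (lie_bracketN (delta_mx i j) (delta_mx k l)).
    rewrite (lie_bracketN (delta_mx k l) (delta_mx a1 b)).
    rewrite (lie_bracketN (delta_mx a1 b) (delta_mx i j)).
    rewrite -[RHS](Bjac (delta_mx i j) (delta_mx k l) (delta_mx a1 b)).
    rewrite -!/(Bd _ _ _ _); apply/matrixP=> p q.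
    move: (lie_bracket _ _) (lie_bracket _ _) (lie_bracket _ _) => u v w.
    by move: (lie_bracket _ _) (lie_bracket _ _) (lie_bracket _ _) => u' v' w'; rewrite !mxE; ring.
have [lam hP] := bracket_family_shape half n_ge3 famP.
(* The linear extension of [a], corrected to absorb the trace terms of [bracket_family_shape]. *)
pose mu (x : 'M[R]_n) := \sum_i \sum_j x i j * a i j - lam * \tr x.
exists lam, mu; have mu_lin : scalar mu.
  move=> s x y; rewrite /mu mxtraceD mxtraceZ.
  suff -> : \sum_i \sum_j (s *: x + y) i j * a i j =
            s * (\sum_i \sum_j x i j * a i j) + \sum_i \sum_j y i j * a i j by ring.
  rewrite mulr_sumr -big_split /=; apply: eq_bigr => i _.
  rewrite mulr_sumr -big_split /=; apply: eq_bigr => j _.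
  by rewrite !mxE mulrDl mulrA.
have mu_delta i j : mu (delta_mx i j) = a i j - lam * (i == j)%:R.
  rewrite /mu; congr (_ - _ * _).
    rewrite (bigD1 i) //= (bigD1 j) //= mxE !eqxx mul1r.
    rewrite big1 => [|k /negbTE kj]; last by rewrite mxE kj andbF mul0r.
    rewrite big1 ?addr0 // => k /negbTE ki; rewrite big1 // => l _.
    by rewrite mxE ki mul0r.
  rewrite /mxtrace (bigD1 i) //= mxE eqxx big1 ?addr0 // => k /negbTE ki.
  by rewrite mxE ki.
split=> //; clearbody mu.
(* The difference is bilinear and symmetric, so its being scalar can be tested on matrix units, one
   argument at a time. *)
pose S x y := B x y - (lam *: (x *m y + y *m x) + mu x *: y + mu y *: x).
have Slin x : linear (S x).
  move=> s y z; rewrite /S Blin mu_lin mulmxDl mulmxDr -scalemxAl -scalemxAr.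
  rewrite !(scalerDr, scalerDl, scalerBr) !scalerA.
  move: (B x y) (B x z) (x *m y) (x *m z) (y *m x) (z *m x) => *.
  by apply/matrixP=> p q; rewrite !mxE; ring.
have Ssym x y : S x y = S y x by rewrite /S Bsym [x *m y + _]addrC addrAC.
have SL x := GRing.isLinear.Build R _ _ _ (S x) (Slin x).
pose SL' x : {linear 'M[R]_n -> 'M[R]_n} := HB.pack (S x) (SL x).
move=> x y; rewrite -[_ - _]/(SL' x y); move: y; apply: is_scalar_mx_linear => k l.
rewrite [SL' x _]Ssym -[S _ x]/(SL' (delta_mx k l) x); move: x; apply: is_scalar_mx_linear => i j.
apply/is_scalar_mxP; exists (c i j k l).
rewrite [SL' _ _]Ssym /S !mu_delta !mul_delta_mx_cond.
have := hP i j k l; rewrite /P -/(Bd i j k l) => /eqP.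
rewrite !subr_eq => /eqP ->; apply/matrixP=> p q.
by rewrite -!scaler_nat !mxE; ring.
Qed.

End CommutingTrace.

(** * Lie isomorphisms *)

Section Jordan.
Variables (R : comNzRingType) (n : nat).

Definition jordan_product (x y : 'M[R]_n) : 'M[R]_n := x *m y + y *m x.

Lemma jordan_productC x y : jordan_product x y = jordan_product y x.
Proof. exact: addrC. Qed.

Lemma jordan_product_linear x : linear (jordan_product x).
Proof.
move=> a y z; rewrite /jordan_product mulmxDl mulmxDr -scalemxAl -scalemxAr.
by rewrite addrACA scalerDr.
Qed.

Lemma jordan_product_jacobi x y z : lie_bracket (jordan_product x y) z
  + lie_bracket (jordan_product y z) x + lie_bracket (jordan_product z x) y = 0.
Proof.
rewrite /lie_bracket /jordan_product !(mulmxDl, mulmxDr) !mulmxA.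
move: (x *m y *m z) (x *m z *m y) (y *m x *m z) => a b c.
move: (y *m z *m x) (z *m x *m y) (z *m y *m x) => d e f.
by apply/matrixP=> p q; rewrite !mxE; ring.
Qed.

Lemma jordan_associator x y z :
  jordan_product (jordan_product x y) z - jordan_product x (jordan_product y z)
  = lie_bracket y (lie_bracket x z).
Proof.
rewrite /lie_bracket /jordan_product !(mulmxDl, mulmxDr, mulNmx, mulmxN) !mulmxA.
move: (x *m y *m z) (x *m z *m y) (y *m x *m z) => a b c.
move: (y *m z *m x) (z *m x *m y) (z *m y *m x) => d e f.
by apply/matrixP=> p q; rewrite !mxE; ring.
Qed.

End Jordan.

Section LieIsomorphism.
Variables (R : idomainType) (n : nat).
Hypothesis half : (2%:R : R) \is a GRing.unit.
Hypothesis n_ge3 : (3 <= n)%N.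
Variables l phi : {linear 'M[R]_n -> 'M[R]_n}.
Hypothesis lK : cancel l phi.
Hypothesis phiK : cancel phi l.
Hypothesis l_lie : forall x y, l (lie_bracket x y) = lie_bracket (l x) (l y).

Local Notation jp := (@jordan_product R n).

(** Scalar matrices form the centre, which [l] both preserves and reflects. *)
Lemma lie_iso_scalar x : is_scalar_mx (l x) -> is_scalar_mx x.
Proof.
move=> /is_scalar_mxP[c lx]; apply: is_scalar_mx_central => z.
by apply: (can_inj lK); rewrite l_lie lx lie_bracket_scalar linear0.
Qed.

Lemma scalar_lie_iso x : is_scalar_mx x -> is_scalar_mx (l x).
Proof.
move=> /is_scalar_mxP[c ->]; apply: is_scalar_mx_central => z.
by rewrite -[z]phiK -l_lie lie_bracket_scalar linear0.
Qed.

Lemma lie_iso_jordan : exists lam (m : {scalar 'M[R]_n}), forall x y,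
  is_scalar_mx (l (jp x y)
                - (lam *: jp (l x) (l y) + (2%:R * m x) *: l y + (2%:R * m y) *: l x)).
Proof.
have Bjac x y z : lie_bracket (l (jp (phi x) (phi y))) z
    + lie_bracket (l (jp (phi y) (phi z))) x + lie_bracket (l (jp (phi z) (phi x))) y = 0.
  rewrite -{1}[z]phiK -{2}[x]phiK -{3}[y]phiK -!l_lie -!linearD.
  by rewrite jordan_product_jacobi linear0.
have [||lam [mu [mu_lin hmu]]] := commuting_trace half n_ge3 _ _ Bjac.
- by move=> x y; rewrite jordan_productC.
- by move=> x a y z; rewrite linearP jordan_product_linear linearP.
(* Halving [mu] prepares completion of the square: the cross terms of [jp (J x) (J y)] carry a
   factor 2. *)
pose m0 x := 2%:R^-1 * mu (l x).
have m_lin : scalar m0 by move=> a x y; rewrite /m0 linearP mu_lin mulrDr mulrCA.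
pose m : {scalar 'M[R]_n} := HB.pack m0 (GRing.isLinear.Build R _ _ _ m0 m_lin).
exists lam, m => x y; rewrite -[m x]/(m0 x) -[m y]/(m0 y) /m0.
by have := hmu (l x) (l y); rewrite !lK !mulrA !divrr // !mul1r.
Qed.

(** * The Jordan part [J] of a Lie isomorphism *)

Section Homomorphism.
Variables (lam : R) (m : {scalar 'M[R]_n}).
Hypothesis hm : forall x y,
  is_scalar_mx (l (jp x y)
                - (lam *: jp (l x) (l y) + (2%:R * m x) *: l y + (2%:R * m y) *: l x)).

Lemma lam_neq0 : lam != 0.
Proof.
have [i [j [k [ij ik jk]]]] := three_indices n_ge3; apply/eqP=> lam0.
(* Here [x o x = 2 e_ik], while [x] has no [(i, k)] entry; with [lam = 0], [x o x] would be a
   multiple of [x] plus a scalar, forcing 2 to vanish. *)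
pose x : 'M[R]_n := delta_mx i j + delta_mx j k.
have := hm x x; rewrite lam0 scale0r add0r -!linearZ -linearD -linearB.
move=> /lie_iso_scalar /is_scalar_mx_offdiag /(_ ik).
rewrite /x /jordan_product !(mulmxDl, mulmxDr) !mul_delta_mx_cond -!scaler_nat !mxE.
neqs; zeros => h; move: half; suff -> : 2%:R = 0 :> R by rewrite unitr0.
by rewrite -h; ring.
Qed.

Definition jordan_part x := lam *: l x + (m x)%:M.
Local Notation J := jordan_part.

Lemma jordan_part_linear : linear J.
Proof.
move=> a x y; rewrite /J !linearP /=; apply/matrixP=> p q.
by rewrite !mxE; ring.
Qed.

HB.instance Definition _ :=
  GRing.isLinear.Build R 'M[R]_n 'M[R]_n _ jordan_part jordan_part_linear.

Lemma jordan_part_scalar x : is_scalar_mx (J x - lam *: l x).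
Proof. by rewrite /J addrC addKr scalar_mx_is_scalar. Qed.

Lemma jordan_part_defect x y : is_scalar_mx (J (jp x y) - jp (J x) (J y)).
Proof.
have /is_scalar_mxP[c hc] := hm x y.
(* The three terms come from [hm] scaled by [lam], from the scalar part of [J (jp x y)], and from
   the product of the scalar parts of [J x] and [J y]. *)
apply/is_scalar_mxP; exists (lam * c + m (jp x y) - 2%:R * m x * m y).
have -> : (lam * c + m (jp x y) - 2%:R * m x * m y)%:M =
   lam *: c%:M + (m (jp x y))%:M - (2%:R * m x * m y)%:M :> 'M[R]_n.
  by rewrite !raddfB raddfD /= scale_scalar_mx.
rewrite -hc {1}/J /J /jordan_product.
rewrite !(mulmxDl, mulmxDr) !(mul_scalar_mx, mul_mx_scalar) -!scalemxAl -!scalemxAr.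
move: (l _) (m _) => u s.
move: (l x *m l y) (l y *m l x) => v w.
apply/matrixP=> p q; rewrite !mxE; ring.
Qed.

Lemma defectP : exists w, forall x y, J (jp x y) = jp (J x) (J y) + (w x y)%:M.
Proof.
have [i _] := three_indices n_ge3.
exists (fun x y => (J (jp x y) - jp (J x) (J y)) i i) => x y.
have /is_scalar_mxP[c hc] := jordan_part_defect x y.
by rewrite hc mxE eqxx mulr1n -hc addrC subrK.
Qed.

Lemma lie_bracket_jordan_part x y :
  lie_bracket (J x) (J y) = lam ^+ 2 *: l (lie_bracket x y).
Proof. by rewrite lie_bracket_affine l_lie. Qed.

(** * Vanishing of the scalar defect [w] *)

Section Defect.
Variable w : 'M[R]_n -> 'M[R]_n -> R.
Hypothesis hw : forall x y, J (jp x y) = jp (J x) (J y) + (w x y)%:M.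

(** Both sides of the associator identity are compared through [J]: an inner defect multiplies the
    outer factor by [2 w], while an outer defect stays scalar. *)
Lemma jordan_part_associator x y z : is_scalar_mx
  (J (lie_bracket y (lie_bracket x z)) - lie_bracket (J y) (lie_bracket (J x) (J z))
   - ((2%:R * w x y) *: J z - (2%:R * w y z) *: J x)).
Proof.
rewrite -!jordan_associator raddfB /= !hw.
apply/is_scalar_mxP; exists (w (jp x y) z - w x (jp y z)).
have jpD u v c : jp u (v + c%:M) = jp u v + (2%:R * c) *: u.
  rewrite /jordan_product mulmxDl mulmxDr mul_scalar_mx mul_mx_scalar addrACA.
  by rewrite -scalerDl -mulr2n mulr_natl.
rewrite (jordan_productC (jp (J x) (J y) + _)) !(jpD _ _ (w _ _)) (jordan_productC (J z)) raddfB /=.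
move: (jp (jp (J x) (J y)) (J z)) (jp (J x) (jp (J y) (J z))) (J x) (J z) => ? ? ? ?.
by apply/matrixP=> p q; rewrite !mxE; ring.
Qed.

(** Modulo scalars [J] is [lam *: l], and the double bracket of [J]-values is [lam ^+ 3 *: l D];
    cancelling [lam] and then [l] leaves a relation among [x], [y], [z]. *)
Lemma defect_relation x y z : is_scalar_mx
  ((1 - lam ^+ 2) *: lie_bracket y (lie_bracket x z)
   - ((2%:R * w x y) *: z - (2%:R * w y z) *: x)).
Proof.
set D := lie_bracket y (lie_bracket x z).
have JD : lie_bracket (J y) (lie_bracket (J x) (J z)) = lam ^+ 3 *: l D.
  rewrite lie_bracket_jordan_part lie_bracketZr lie_bracketDl lie_bracket_scalar.
  by rewrite addr0 lie_bracketZl -l_lie scalerA -exprSr.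
apply: lie_iso_scalar; apply: (is_scalar_mxZ_inv lam_neq0).
have := jordan_part_associator x y z; rewrite JD -/D.
have /is_scalar_mxP[d hd] := jordan_part_scalar D.
have /is_scalar_mxP[cx hx] := jordan_part_scalar x.
have /is_scalar_mxP[cz hz] := jordan_part_scalar z.
move=> /is_scalar_mxP[c hc]; apply/is_scalar_mxP.
exists (c - d + (2%:R * w x y * cz - 2%:R * w y z * cx)).
have -> : (c - d + (2%:R * w x y * cz - 2%:R * w y z * cx))%:M
    = c%:M - d%:M + ((2%:R * w x y) *: cz%:M - (2%:R * w y z) *: cx%:M) :> 'M[R]_n.
  by apply/matrixP=> p q; rewrite !mxE; ring.
rewrite -hd -hc -hx -hz; clearbody D; rewrite ![l (_ - _)]linearB ![l (_ *: _)]linearZ /=.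
move: (J D) (J x) (J z) (l D) (l x) (l z) => ? ? ? ? ? ?.
by apply/matrixP=> p q; rewrite !mxE; ring.
Qed.

Lemma defect_lam_sqr : lam ^+ 2 = 1.
Proof.
have [i [j [k [ij ik jk]]]] := three_indices n_ge3.
(* The double bracket is [e_ik], and neither [x = e_ij] nor [z = e_jk] has an [(i, k)] entry. *)
have := defect_relation (delta_mx i j) (delta_mx i i) (delta_mx j k).
rewrite !bracket_delta // => /is_scalar_mx_offdiag /(_ ik).
by rewrite !mxE; neqs; zeros => /eqP; rewrite subr_eq0 eq_sym => /eqP.
Qed.

Lemma defect_delta i j y : w (delta_mx i j) y = 0.
Proof.
have [k [ki _]] := fresh_ord n_ge3 i i; have [h [hk _]] := fresh_ord n_ge3 k k.
rewrite eq_sym in hk.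
(* As [k != i], the [(k, h)] entry ignores [e_ij] and isolates [2 w(e_ij, y)]. *)
have := defect_relation (delta_mx i j) y (delta_mx k h).
rewrite defect_lam_sqr subrr scale0r sub0r => /is_scalar_mx_offdiag /(_ hk).
rewrite !mxE; neqs; zeros => /eqP.
rewrite oppr_eq0 mulf_eq0 => /orP[/eqP h2|/eqP //].
by move: half; rewrite h2 unitr0.
Qed.

End Defect.

(** The defect is linear in [x], so its vanishing on matrix units suffices. *)
Lemma jordan_part_jp x y : J (jp x y) = jp (J x) (J y).
Proof.
have [w hw] := defectP.
have lin : linear (fun x => J (jp y x) - jp (J y) (J x)).
  move=> a u v; rewrite jordan_product_linear !jordan_part_linear jordan_product_linear.
  move: (J (jp y u)) (J (jp y v)) (jp (J y) (J u)) (jp (J y) (J v)) => ? ? ? ?.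
  by apply/matrixP=> p q; rewrite !mxE; ring.
pose f : {linear 'M[R]_n -> 'M[R]_n} :=
  HB.pack (fun x => J (jp y x) - jp (J y) (J x)) (GRing.isLinear.Build R _ _ _ _ lin).
apply/eqP; rewrite -subr_eq0 [jp x y]jordan_productC [jp (J x) _]jordan_productC.
apply/eqP; apply: (@linear_delta_eq0 _ _ _ f) => i j /=.
rewrite jordan_productC [jp (J y) _]jordan_productC hw (defect_delta hw).
by rewrite raddf0 addr0 subrr.
Qed.

Lemma lam_sqr : lam ^+ 2 = 1.
Proof. by have [w hw] := defectP; apply: (defect_lam_sqr hw). Qed.

(** * The functional [m] as a multiple of the trace *)

Lemma jordan_part_double_bracket x y z :
  J (lie_bracket y (lie_bracket x z)) = lam *: l (lie_bracket y (lie_bracket x z)).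
Proof.
transitivity (lie_bracket (J y) (lie_bracket (J x) (J z))).
  by rewrite -!jordan_associator raddfB /= !jordan_part_jp.
rewrite lie_bracket_jordan_part lam_sqr scale1r lie_bracketDl lie_bracket_scalar.
by rewrite addr0 lie_bracketZl -l_lie.
Qed.

Lemma functional_double_bracket x y z : m (lie_bracket y (lie_bracket x z)) = 0.
Proof.
have [i _] := three_indices n_ge3.
have /eqP := jordan_part_double_bracket x y z.
rewrite -subr_eq0 /J addrAC subrr add0r => /eqP/matrixP/(_ i i).
by rewrite !mxE eqxx.
Qed.

Lemma functional_offdiag i j : i != j -> m (delta_mx i j) = 0.
Proof.
move=> ij; have [k [ki kj]] := fresh_ord n_ge3 i j.
(* Uses [e_ij = [e_ii, [e_ik, e_kj]]]. *)
have := functional_double_bracket (delta_mx i k) (delta_mx i i) (delta_mx k j).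
by rewrite !bracket_delta.
Qed.

Lemma functional_diag i j : m (delta_mx i i) = m (delta_mx j j).
Proof.
have [<-//|ij] := eqVneq i j; have [k [ki kj]] := fresh_ord n_ge3 i j.
(* Uses [e_ii - e_jj = [e_ij, [e_jk, e_ki]]]. *)
have := functional_double_bracket (delta_mx j k) (delta_mx i j) (delta_mx k i).
rewrite bracket_delta 1?eq_sym // /lie_bracket !mul_delta_mx linearB.
by move/eqP; rewrite subr_eq0 => /eqP.
Qed.

(* [m] kills double brackets, and these span the kernel of the trace. *)
Lemma functional_trace x i : m x = m (delta_mx i i) * \tr x.
Proof.
rewrite {1}(matrix_sum_delta x) linear_sum /mxtrace mulr_sumr; apply: eq_bigr => k _.
rewrite linear_sum (bigD1 k) //= big1 => [|j jk].
  by rewrite linearZ /= addr0 mulrC (functional_diag k i).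
by rewrite linearZ /= functional_offdiag ?mulr0 // eq_sym.
Qed.

Lemma functional_bracket x y : m (lie_bracket x y) = 0.
Proof.
have [i _] := three_indices n_ge3.
by rewrite (functional_trace _ i) /lie_bracket raddfB /= mxtrace_mulC subrr mulr0.
Qed.

(** * Multiplicativity and bijectivity of [J] *)

Lemma jordan_part_bracket x y :
  J (lie_bracket x y) = lam *: lie_bracket (J x) (J y).
Proof.
by rewrite lie_bracket_jordan_part lam_sqr scale1r {1}/J functional_bracket raddf0 addr0.
Qed.

Lemma jordan_part_double_mul x y :
  2%:R *: J (x *m y) = jp (J x) (J y) + lam *: lie_bracket (J x) (J y).
Proof.
rewrite -jordan_part_jp -jordan_part_bracket -linearD -linearZ; congr (J _).
by rewrite /jordan_product /lie_bracket addrACA subrr addr0 -mulr2n scaler_nat.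
Qed.

(** From [2 x y = x o y + [x, y]]: the sign [lam] of the bracket decides the order of the
    factors. *)
Lemma jordan_part_mul x y :
  J (x *m y) = if lam == 1 then J x *m J y else J y *m J x.
Proof.
have halfK (A : 'M[R]_n) : A = 2%:R^-1 *: (2%:R *: A) by rewrite scalerA mulVr // scale1r.
rewrite [LHS]halfK [RHS]halfK jordan_part_double_mul; congr (_ *: _).
rewrite /jordan_product /lie_bracket; move: (J x *m J y) (J y *m J x) => u v.
case: (eqVneq lam 1) => [->|lam1].
  by apply/matrixP=> p q; rewrite !mxE; ring.
have -> : lam = -1.
  by have /eqP := lam_sqr; rewrite sqrf_eq1 (negbTE lam1) => /eqP.
by apply/matrixP=> p q; rewrite !mxE; ring.
Qed.

Lemma jordan_part_scalar_inv x : is_scalar_mx (J x) -> is_scalar_mx x.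
Proof.
move=> Jx; apply: lie_iso_scalar; apply: (is_scalar_mxZ_inv lam_neq0).
by rewrite -[_ *: _](addrK (m x)%:M) is_scalar_mxB // scalar_mx_is_scalar.
Qed.

(** [J 1] is a scalar [c] with [c *: J x = J x] for all [x]. If [c = 0] then [J e_ij = 0], so the
    off-diagonal unit [e_ij] would be scalar; otherwise [c] cancels from [c * c = c]. *)
Lemma jordan_part1 : J 1%:M = 1%:M.
Proof.
have [i [j [_ [ij _ _]]]] := three_indices n_ge3.
have /is_scalar_mxP[c J1] : is_scalar_mx (J 1%:M).
  apply: is_scalar_mxD; last exact: scalar_mx_is_scalar.
  by apply: is_scalar_mxZ; apply: scalar_lie_iso; apply: scalar_mx_is_scalar.
have cJ x : c *: J x = J x.
  have := jordan_part_mul 1%:M x; rewrite mul1mx J1.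
  by rewrite mul_scalar_mx mul_mx_scalar if_same => /esym.
have [c0|c_neq0] := eqVneq c 0; last first.
  have /matrixP/(_ i i) := cJ 1%:M; rewrite J1 !mxE eqxx mulr1n.
  by rewrite -{3}[c]mulr1 => /(mulfI c_neq0) ->.
have : is_scalar_mx (J (delta_mx i j)).
  by rewrite -cJ c0 scale0r -(raddf0 (@scalar_mx R n)) scalar_mx_is_scalar.
move=> /jordan_part_scalar_inv/is_scalar_mx_offdiag/(_ ij)/eqP.
by rewrite mxE !eqxx oner_eq0.
Qed.

Lemma jordan_part_scalar_mx c : J c%:M = c%:M.
Proof. by rewrite -scalemx1 linearZ /= jordan_part1. Qed.

Lemma jordan_part_bij : bijective J.
Proof.
(* Since [lam ^+ 2 = 1], [J (phi (lam *: y))] exceeds [y] by the scalar [m (phi (lam *: y))], and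
   [J] fixes scalars. *)
pose K y := phi (lam *: y) - (m (phi (lam *: y)))%:M.
have KJ : cancel K J.
  move=> y; rewrite /K (linearB J) /= jordan_part_scalar_mx /J phiK scalerA -expr2.
  by rewrite lam_sqr scale1r addrK.
exists K => //; apply: (inj_can_sym KJ).
(* The kernel of [J] consists of scalar matrices, which [J] fixes, so it is zero. *)
apply: raddf_inj => x; rewrite -[_ x]/(J x) => Jx0.
have /jordan_part_scalar_inv/is_scalar_mxP[c xc] : is_scalar_mx (J x).
  by rewrite Jx0 -(raddf0 (@scalar_mx R n)) scalar_mx_is_scalar.
by move: Jx0; rewrite xc jordan_part_scalar_mx.
Qed.

Lemma lie_iso_decomposition x : l x = lam *: J x + (- (lam * m x))%:M.
Proof.
rewrite /J scalerDr scalerA -expr2 lam_sqr scale1r scale_scalar_mx.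
by rewrite raddfN addrK.
Qed.

End Homomorphism.
End LieIsomorphism.

Theorem corollary4p7 (R : idomainType) (half_in_R : (2%:R : R) \is a GRing.unit)
    (n : nat) (n_ge3 : (3 <= n)%N)
    (l : 'M[R]_n -> 'M[R]_n) (l_lie : lie_isomorphism l) :
  exists m nn : 'M[R]_n -> 'M[R]_n,
    [/\ forall x, l x = m x + nn x,
        algebra_isomorphism m \/
          (exists2 a, algebra_antiisomorphism a & forall x, m x = - a x),
        linear nn,
        forall x, exists r : R, nn x = r%:M &
        forall x y, nn (lie_bracket x y) = 0].
Proof.
case: l_lie => l_lin [phi lK phiK] l_br.
pose L : {linear 'M[R]_n -> 'M[R]_n} := HB.pack l (GRing.isLinear.Build R _ _ _ l l_lin).
have phi_lin : linear phi := can2_linear (f := L) lK phiK.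
pose Phi : {linear 'M[R]_n -> 'M[R]_n} :=
  HB.pack phi (GRing.isLinear.Build R _ _ _ phi phi_lin).
have LK : cancel L Phi := lK; have PhiK : cancel Phi L := phiK.
have L_br x y : L (lie_bracket x y) = lie_bracket (L x) (L y) := l_br x y.
have [lam [m hm]] := lie_iso_jordan half_in_R n_ge3 LK PhiK L_br.
pose J := jordan_part L lam m.
have J_lin : linear J := jordan_part_linear L lam m.
have J_bij : bijective J := jordan_part_bij half_in_R n_ge3 LK PhiK L_br hm.
have J1 : J 1%:M = 1%:M := jordan_part1 half_in_R n_ge3 LK PhiK L_br hm.
have Jmul := jordan_part_mul half_in_R n_ge3 LK L_br hm.
(* With [lam ^+ 2 = 1], [lam *: J] is either the isomorphism [J] or the negative of the
   anti-isomorphism [J]. *)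
have [mm mmE mm_iso] : exists2 mm : 'M[R]_n -> 'M[R]_n, forall x, mm x = lam *: J x &
    algebra_isomorphism mm \/
    (exists2 a, algebra_antiisomorphism a & forall x, mm x = - a x).
  have := lam_sqr half_in_R n_ge3 LK L_br hm.
  move/eqP; rewrite sqrf_eq1; case: (eqVneq lam 1) => [lam1 _|lam1 /eqP lamN1].
    exists J => [x|]; first by rewrite lam1 scale1r.
    by left; split=> //; split=> // x y; rewrite [LHS]Jmul ifT // lam1.
  exists (fun x => - J x) => [x|]; first by rewrite lamN1 scaleN1r.
  right; exists J => //; split=> //; split=> // x y.
  by rewrite [LHS]Jmul (negbTE lam1).
exists mm, (fun x => (- (lam * m x))%:M); split=> //.
- by move=> x; rewrite mmE; apply: (lie_iso_decomposition half_in_R n_ge3 LK L_br hm).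
- move=> a x y; rewrite linearP /=; apply/matrixP=> p q.
  by rewrite !mxE; ring.
- by move=> x; exists (- (lam * m x)).
- move=> x y; rewrite (functional_bracket half_in_R n_ge3 LK L_br hm).
  by rewrite mulr0 oppr0 raddf0.
Qed.
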